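(* Let $G$ be a finite group. If $\mathrm{pr}^*_G(2',2')>7/15$, then $G$ is soluble.
   Context: For subsets $X,Y$ of a finite group $G$, $\Pr(X,Y)=|\{(x,y)\in X\times Y: xy=yx\}|/(|X||Y|)$. For sets of primes $\pi_1,\pi_2$, $\mathrm{pr}^*_G(\pi_1,\pi_2)$ denotes the maximum real number $\epsilon$ such that for every pair of distinct primes $p\in\pi_1$, $q\in\pi_2$ there exist a Sylow $p$-subgroup $P$ and a Sylow $q$-subgroup $Q$ of $G$ with $\Pr(P,Q)\ge\epsilon$ (the Sylow $p$-subgroup is taken to be trivial if $p\nmid|G|$). For a prime $r$, $r'$ denotes the set of all primes different from $r$; so $2'$ is the set of odd primes. *)

(* Defs.v *)
From mathcomp Require Import all_boot all_order all_algebra all_fingroup all_solvable.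
Set Implicit Arguments. Unset Strict Implicit. Unset Printing Implicit Defensive.
Import GRing.Theory Num.Theory.
Local Open Scope ring_scope.

Definition comm_prob (gT : finGroupType) (X Y : {set gT}) : rat :=
  (#|[set xy in setX X Y | (xy.1 * xy.2 == xy.2 * xy.1)%g]|)%:R
    / (#|X| * #|Y|)%N%:R.

(* eps is admissible for pr*_G(pi1,pi2): for every pair of distinct primes
   p in pi1, q in pi2 there are Sylow p- and q-subgroups P, Q of G with
   Pr(P,Q) >= eps.  (MathComp's 'Syl_p(G) is {1} when p does not divide |G|.) *)
Definition prstar_admissible (gT : finGroupType) (G : {group gT})
    (pi1 pi2 : nat -> bool) (eps : rat) : Prop :=
  forall p q : nat, prime p -> prime q -> pi1 p -> pi2 q -> p <> q ->
    exists P : {group gT}, exists Q : {group gT},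
      [/\ P \in ('Syl_p(G))%g, Q \in ('Syl_q(G))%g & eps <= comm_prob P Q].

(* pr*_G(pi1,pi2) is the maximum admissible eps; since admissibility is
   downward closed, pr*_G(pi1,pi2) > c iff some admissible eps exceeds c. *)
Definition prstar_gt (gT : finGroupType) (G : {group gT})
    (pi1 pi2 : nat -> bool) (c : rat) : Prop :=
  exists eps : rat, c < eps /\ prstar_admissible G pi1 pi2 eps.

Definition not2 (p : nat) : bool := p != 2%N.

(* Main.v *)
Require Import Defs.
From mathcomp Require Import all_boot all_order all_algebra all_fingroup all_solvable.
From mathcomp Require Import integral_char zify.
Import GroupScope Order.TTheory GRing.Theory Num.Theory.
Set Implicit Arguments. Unset Strict Implicit. Unset Printing Implicit Defensive.
Local Open Scope ring_scope.

(** If [P] and [Q] do not centralise each other then Pr(P, Q) is at most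
    (p + q - 1)/(pq), which is at most 7/15 for distinct odd primes; so the
    hypothesis forces commuting Sylow p- and q-subgroups for all distinct odd
    p, q.  This passes to normal subgroups and quotients, so a minimal
    counterexample is simple.  There, a nontrivial element of the centre of a
    Sylow subgroup of odd order is centralised by a Sylow r-subgroup for every
    odd r, so its class has 2-power size, contradicting Burnside's theorem. *)

Lemma card_commuting_pairs (gT : finGroupType) (P Q : {group gT}) :
  #|[set xy in setX P Q | (xy.1 * xy.2 == xy.2 * xy.1)%g]|
    = (\sum_(x in P) #|'C_Q[x]%g|)%N.
Proof.
rewrite -sum1_card.
under [RHS]eq_bigr do rewrite -sum1_card.
rewrite pair_big_dep; apply: eq_bigl => -[x y] /=.
by rewrite inE in_setX in_setI cent1E /= -andbA [_ == (y * x)%g]eq_sym.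
Qed.

Lemma pgroup_proper_card (gT : finGroupType) (p : nat) (H P : {group gT}) :
  p.-group P -> H \proper P -> (p * #|H| <= #|P|)%N.
Proof.
move=> pP /andP[sHP nsPH]; rewrite mulnC -(Lagrange sHP) leq_pmul2l ?cardG_gt0 //.
have pPH : p.-nat #|P : H|%g := pnat_dvd (dvdn_indexg P H) pP.
have iPH : (1 < #|P : H|%g)%N by rewrite indexg_gt1.
have /eqP <- : pdiv #|P : H|%g == p by apply: (pnatPpi pPH); rewrite pi_pdiv.
exact: dvdn_leq (pdiv_dvd _).
Qed.

(** At most |P|/p elements of [P] centralise [Q], and each of the others commutes with at most |Q|/q
    elements of [Q]. The count is largest when |C_P(Q)| = |P|/p, where its share of |P||Q| is 1/p +
    (1 - 1/p)/q. *)
Lemma card_commuting_pairs_bound (gT : finGroupType) (p q : nat) (P Q : {group gT}) :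
    (0 < p)%N -> (0 < q)%N ->
    p.-group P -> q.-group Q -> ~~ (P \subset 'C(Q)%g) ->
  (p * q * #|[set xy in setX P Q | (xy.1 * xy.2 == xy.2 * xy.1)%g]|
    <= (p + q - 1) * (#|P| * #|Q|))%N.
Proof.
move=> p_gt0 q_gt0 pP qQ nCPQ; rewrite card_commuting_pairs.
have pC : (p * #|'C_P(Q)%g| <= #|P|)%N.
  by apply: pgroup_proper_card; rewrite // properE subsetIl subsetI subxx.
rewrite (big_setID 'C(Q)%g) /=.
have central : (\sum_(x in P :&: 'C(Q)%g) #|'C_Q[x]%g| = #|'C_P(Q)%g| * #|Q|)%N.
  rewrite -sum_nat_const; apply: eq_bigr => x /setIP[_ cQx].
  by rewrite (setIidPl _) // sub_cent1.
have noncentral : (q * \sum_(x in P :\: 'C(Q)%g) #|'C_Q[x]%g|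
    <= (#|P| - #|'C_P(Q)%g|) * #|Q|)%N.
  rewrite -cardsD -sum_nat_const big_distrr /=.
  apply: leq_sum => x /setDP[_ ncQx]; apply: pgroup_proper_card => //.
  by rewrite properE subsetIl subsetI subxx sub_cent1.
rewrite central; move: noncentral pC (subset_leq_card (subsetIl P 'C(Q)%g)).
move: (\sum_(x in P :\: _) _)%N #|'C_P(Q)%g| #|P| #|Q| => s c a b.
case: q q_gt0 {qQ} => // q _; case: p p_gt0 {pP} => // p _ leqs lepc leca.
(* From here [p] and [q] stand for the predecessors of the primes. Collecting the terms in [c]
   leaves the nonnegative coefficient [q * b], so the upper bound [lepc] on [c] can be inserted. *)
have leq_q : (q.+1 * (c * b + s) <= c * (q * b) + a * b)%N.
  by move: leqs; rewrite mulnBl; have := leq_mul leca (leqnn b); nia.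
have := leq_mul lepc (leqnn (q * b)); have := leq_mul (leqnn p.+1) leq_q.
nia.
Qed.

(** The ratio (p + q - 1)/(pq) equals 1 - (1 - 1/p)(1 - 1/q), which decreases in each prime; the
    extreme pair {3, 5} gives exactly 7/15. *)
Lemma odd_primes_bound (p q : nat) :
  prime p -> prime q -> p != 2 -> q != 2 -> p != q ->
  (15 * (p + q - 1) <= 7 * (p * q))%N.
Proof.
move=> p_pr q_pr p2 q2 pq.
(* With 4 excluded, two distinct integers above 2 are at least 3 and 5 in some order. *)
have [p4 q4] : p != 4 /\ q != 4.
  by split; [case: eqP p_pr => // -> | case: eqP q_pr => // ->].
by have := prime_gt1 p_pr; have := prime_gt1 q_pr; nia.
Qed.

Lemma comm_prob_gt_cents (gT : finGroupType) (p q : nat) (P Q : {group gT}) :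
    prime p -> prime q -> p != 2 -> q != 2 -> p != q ->
    p.-group P -> q.-group Q -> 7%:R / 15%:R < comm_prob P Q ->
  P \subset 'C(Q)%g.
Proof.
move=> p_pr q_pr p2 q2 pq pP qQ; apply: contraTT => ncPQ; rewrite -leNgt.
have PQ_gt0 : (0 < #|P| * #|Q|)%N by rewrite muln_gt0 !cardG_gt0.
have p_gt0 := prime_gt0 p_pr; have q_gt0 := prime_gt0 q_pr.
rewrite /comm_prob ler_pdivrMr ?ltr0n // mulrAC ler_pdivlMr ?ltr0n //.
rewrite -!natrM ler_nat.
have := card_commuting_pairs_bound p_gt0 q_gt0 pP qQ ncPQ.
have := odd_primes_bound p_pr q_pr p2 q2 pq.
have : (0 < p * q)%N by rewrite muln_gt0 p_gt0.
move: #|_| (_ * _)%N (_ * _)%N PQ_gt0 (p + q - 1)%N => c a b; nia.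
Qed.

Definition odd_Sylows_commute (gT : finGroupType) (G : {group gT}) : Prop :=
  forall p q : nat, prime p -> prime q -> p != 2 -> q != 2 -> p != q ->
  exists P : {group gT}, exists Q : {group gT},
    [/\ p.-Sylow(G) P, q.-Sylow(G) Q & P \subset 'C(Q)%g].

Lemma prstar_gt_odd_Sylows_commute (gT : finGroupType) (G : {group gT}) :
  prstar_gt G not2 not2 (7%:R / 15%:R) -> odd_Sylows_commute G.
Proof.
move=> [eps [lt_eps admG]] p q p_pr q_pr p2 q2 pq.
have [P [Q []]] := admG p q p_pr q_pr p2 q2 (elimN eqP pq).
rewrite !inE => sylP sylQ le_eps; exists P, Q; split=> //.
have [pP qQ] := (pHall_pgroup sylP, pHall_pgroup sylQ).
exact: (comm_prob_gt_cents p_pr q_pr) (lt_le_trans lt_eps le_eps).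
Qed.

Lemma odd_Sylows_commute_normal (gT : finGroupType) (G N : {group gT}) :
  (N <| G)%g -> odd_Sylows_commute G -> odd_Sylows_commute N.
Proof.
move=> nsNG cG p q p_pr q_pr p2 q2 pq.
have [P [Q [sylP sylQ cPQ]]] := cG p q p_pr q_pr p2 q2 pq.
exists (N :&: P)%G, (N :&: Q)%G; split; try exact: Sylow_setI_normal nsNG _.
by rewrite subIset // (subset_trans cPQ) ?orbT // centS ?subsetIr.
Qed.

Lemma odd_Sylows_commute_quotient (gT : finGroupType) (G N : {group gT}) :
  (N <| G)%g -> odd_Sylows_commute G -> odd_Sylows_commute (G / N)%G.
Proof.
move=> /andP[_ nNG] cG p q p_pr q_pr p2 q2 pq.
have [P [Q [sylP sylQ cPQ]]] := cG p q p_pr q_pr p2 q2 pq.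
have nNS r (S : {group gT}) : r.-Sylow(G) S -> S \subset 'N(N)%g.
  by move/pHall_sub => sSG; apply: subset_trans sSG nNG.
exists (P / N)%G, (Q / N)%G; split; last exact: quotient_cents.
  by apply: quotient_pHall; rewrite ?(nNS p).
by apply: quotient_pHall; rewrite ?(nNS q).
Qed.

(** The class size is the index of ['C_G[x]], which divides the index of [R], a number prime to
    [r]. *)
Lemma Sylow_sub_cent1_class (gT : finGroupType) (r : nat) (G R : {group gT}) x :
  r.-Sylow(G) R -> R \subset 'C[x]%g -> r \notin \pi(#|(x ^: G)%g|).
Proof.
case/and3P=> sRG rR r'GR cRx; rewrite -index_cent1.
have sRC : R \subset 'C_G[x]%g by rewrite subsetI sRG.
have r'GC : r^'.-nat #|G : 'C_G[x]|%g := pnat_dvd (indexgS G sRC) r'GR.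
by apply/negP=> /(pnatPpi r'GC); rewrite !inE eqxx.
Qed.

Lemma simple_nsol_not_odd_Sylows_commute (gT : finGroupType) (G : {group gT}) :
  simple G -> ~~ solvable G -> ~ odd_Sylows_commute G.
Proof.
move=> simG nsolG cG.
have ncG : ~~ abelian G by apply: contra nsolG; apply: abelian_sol.
have [p pG p2] : exists2 p, p \in \pi(#|G|) & p != 2.
  have : ~~ 2.-group G by apply: contra nsolG; apply: pgroup_sol.
  rewrite /pgroup /pnat cardG_gt0 => /allPn[p pG p2].
  by exists p.
have p_pr : prime p by move: pG; rewrite mem_primes => /and3P[].
have [P sylP] := Sylow_exists p G; have [sPG pP _] := and3P sylP.
have ntP : P :!=: 1%g by rewrite -rank_gt0 (rank_Sylow sylP) p_rank_gt0.
have ntZ : 'Z(P)%g != 1%g by apply: contraNneq ntP => /(trivg_center_pgroup pP) ->.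
have [x /setIP[Px cPx] ntx] := trivgPn _ ntZ.
have Gx := subsetP sPG x Px.
have clG : (x ^: G)%g \in ((classes G)^#)%g.
  by rewrite !inE classG_eq1 ntx mem_classes.
(* Burnside: in a nonabelian simple group the size of a nontrivial class has at least two prime
   divisors. *)
have := primes_class_simple_gt1 simG ncG clG.
suffices : {subset primes #|(x ^: G)%g| <= [:: 2%N]}.
  by move/(uniq_leq_size (primes_uniq _))=> /=; rewrite ltnNge => ->.
move=> q qC; rewrite inE; apply: contraLR qC => q2.
have [q_pr | q_npr] := boolP (prime q); last first.
  by rewrite mem_primes (negPf q_npr).
have [-> | pq] := eqVneq q p.
  by apply: (Sylow_sub_cent1_class sylP); rewrite sub_cent1.
have [P1 [Q [sylP1 sylQ cP1Q]]] := cG p q p_pr q_pr p2 q2 (contra_neq esym pq).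
(* The commuting pair need not involve [P] itself; conjugating it by [g^-1] carries [P1] to [P], so
   [Q :^ g^-1] centralises [x]. *)
have [g Gg defP1] := Sylow_trans sylP sylP1.
have sylQ1 : q.-Sylow(G) (Q :^ g^-1)%G.
  by rewrite pHallJ ?groupV.
apply: (Sylow_sub_cent1_class sylQ1).
rewrite /= sub_cent1 centJ mem_conjgV (subsetP cP1Q) // defP1.
by rewrite memJ_conjg.
Qed.

Lemma odd_Sylows_commute_sol (gT : finGroupType) (G : {group gT}) :
  odd_Sylows_commute G -> solvable G.
Proof.
(* The induction also generalises [gT], because [G / N] lives in a different group type. *)
have [n] := ubnP #|G|; elim: n gT G => // n IHn gT G; rewrite ltnS => leGn cG.
apply/idPn => nsolG.
apply: simple_nsol_not_odd_Sylows_commute (nsolG) (cG).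
apply/simpleP; split=> [|N nsNG].
  by apply: contraNneq nsolG => ->; apply: solvable1.
have [-> | ntN] := eqVneq (N : {set gT}) 1%g; first by left.
have [-> | neNG] := eqVneq (N : {set gT}) G; first by right.
case/negP: nsolG; rewrite (series_sol nsNG).
have solN : solvable N.
  apply: IHn (odd_Sylows_commute_normal nsNG cG); apply: leq_trans leGn.
  by apply: proper_card; rewrite properEneq neNG normal_sub.
have solGN : solvable (G / N)%g.
  apply: (IHn _ (G / N)%G); last exact: odd_Sylows_commute_quotient.
  by apply: leq_trans leGn; apply: ltn_quotient (normal_sub nsNG).
by rewrite solN.
Qed.

Theorem theorem1p4 (gT : finGroupType) (G : {group gT}) :
  prstar_gt G not2 not2 (7%:R / 15%:R) -> solvable G.
Proof. by move/prstar_gt_odd_Sylows_commute/odd_Sylows_commute_sol. Qed.
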